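(* Let $T=(\Omega,(\Pi_i,t_i)_{i\in N})$ be an information structure and let $p\in\Delta(\Omega)$ be a strongly maximal probability distribution. Then exactly one of the following statements holds: (1) $p$ is a strong common prior; (2) $p$ is a strong multiplayer money pump.
   Context: $\Omega$ is a finite nonempty set of states, $N=\{1,\dots,n\}$ is a finite nonempty set of players, and $\Delta(\Omega)$ is the set of probability measures on $\Omega$ (all subsets measurable). An information structure is a tuple $T=(\Omega,(\Pi_i,t_i)_{i\in N})$ where, for each $i$, $\Pi_i$ is a partition of $\Omega$ and $t_i\colon\Omega\to\Delta(\Omega)$ satisfies $t_i(\omega)(\pi_i(\omega))=1$ for every $\omega$, where $\pi_i(\omega)$ is the element of $\Pi_i$ containing $\omega$, and $t_i$ is constant on each element of $\Pi_i$. A prior of player $i$ is a $p\in\Delta(\Omega)$ such that $p(E\cap\pi)=t_i(\omega)(E)\,p(\pi)$ for all $E\subseteq\Omega$, $\pi\in\Pi_i$, $\omega\in\pi$; a common prior is a $p\in\Delta(\Omega)$ that is a prior of every player. A distribution $p\in\Delta(\Omega)$ is strongly maximal if $p(\pi_i)>0$ for every $i\in N$ and every $\pi_i\in\Pi_i$. A strong common prior is a common prior $p$ with $p(\pi_i)>0$ for every $i\in N$ and every $\pi_i\in\Pi_i$. A nonempty set $S\subseteq\Omega$ is a common certainty component if for every $\omega\in S$ and $i\in N$ there is $E\subseteq S$ with $t_i(\omega)(E)=1$. An event $E\subseteq\Omega$ is commonly certain at $\omega$ if there is a common certainty component $S$ with $\omega\in S\subseteq E$. A semi-trade is a family $(f_i)_{i\in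 N}$ of functions $f_i\colon\Omega\to\mathbb{R}$ such that at every state $\omega\in\Omega$ the event $\{\omega'\in\Omega:\int f_i\,\mathrm{d}t_i(\omega')\ge 0\text{ for all }i\in N\}$ is commonly certain. A distribution $p$ is a multiplayer money pump if there exists a semi-trade $(f_i)_{i\in N}$ with $\int\sum_{i\in N}f_i\,\mathrm{d}p<0$. A strong multiplayer money pump is a strongly maximal distribution that is a multiplayer money pump. *)

(* Defs.v *)
From mathcomp Require Import all_boot all_order all_algebra.
From mathcomp Require Import reals.

Set Implicit Arguments.
Unset Strict Implicit.
Unset Printing Implicit Defensive.

Import Order.TTheory GRing.Theory Num.Theory.
Local Open Scope ring_scope.

(* Since Omega is finite and every subset is measurable, a probability measure
   on Omega is given by its point masses. *)
Record dist (R : realType) (Omega : finType) := Dist {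
  mass :> {ffun Omega -> R};
  mass_ge0 : forall w, 0 <= mass w;
  mass_sum1 : \sum_w mass w = 1
}.

Definition Pr (R : realType) (Omega : finType) (p : dist R Omega)
  (E : {set Omega}) : R := \sum_(w in E) p w.

Definition integral (R : realType) (Omega : finType) (p : dist R Omega)
  (f : Omega -> R) : R := \sum_w f w * p w.

Record info_structure (R : realType) (Omega : finType) (n : nat) :=
  InfoStructure {
    part : 'I_n -> {set {set Omega}};
    belief : 'I_n -> Omega -> dist R Omega;
    part_partition : forall i, partition (part i) [set: Omega];
    belief_cell : forall i w, Pr (belief i w) (pblock (part i) w) = 1;
    belief_const : forall i (c : {set Omega}), c \in part i ->
      forall w w', w \in c -> w' \in c -> belief i w = belief i w'
  }.

Section Notions.
Variables (R : realType) (Omega : finType) (n : nat).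
Variable T : info_structure R Omega n.

Definition prior (i : 'I_n) (p : dist R Omega) : Prop :=
  forall (E c : {set Omega}) (w : Omega), c \in part T i -> w \in c ->
    Pr p (E :&: c) = Pr (belief T i w) E * Pr p c.

Definition common_prior (p : dist R Omega) : Prop := forall i, prior i p.

Definition strongly_maximal (p : dist R Omega) : Prop :=
  forall (i : 'I_n) (c : {set Omega}), c \in part T i -> 0 < Pr p c.

Definition strong_common_prior (p : dist R Omega) : Prop :=
  common_prior p /\
  (forall (i : 'I_n) (c : {set Omega}), c \in part T i -> 0 < Pr p c).

Definition common_certainty_component (S : {set Omega}) : Prop :=
  S != set0 /\
  (forall (w : Omega) (i : 'I_n), w \in S ->
     exists E : {set Omega}, E \subset S /\ Pr (belief T i w) E = 1).

Definition commonly_certain (E : {set Omega}) (w : Omega) : Prop :=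
  exists S : {set Omega},
    [/\ common_certainty_component S, w \in S & S \subset E].

Definition semi_trade (f : 'I_n -> Omega -> R) : Prop :=
  forall w : Omega,
    commonly_certain
      [set w' | [forall i, 0 <= integral (belief T i w') (f i)]] w.

Definition money_pump (p : dist R Omega) : Prop :=
  exists f : 'I_n -> Omega -> R,
    semi_trade f /\ integral p (fun w => \sum_(i < n) f i w) < 0.

Definition strong_money_pump (p : dist R Omega) : Prop :=
  strongly_maximal p /\ money_pump p.

End Notions.

(* Main.v *)
(* Under a prior [p] of player [i], the beliefs of [i] disintegrate [p], so
   [p] integrates [f i] to the [p]-average of the conditional integrals of [f i];
   for a semi-trade these are all nonnegative.  Conversely, if the prior equation
   of player [i] fails at [E] and [c], player [i] alone can bet, inside the cell
   [c], on [E] against its conditional probability: every conditional integral of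
   the bet vanishes, while its [p]-integral is the nonzero defect of the prior
   equation, whose sign is adjusted by scaling. *)
Require Import Defs.
From mathcomp Require Import all_boot all_order all_algebra.
From mathcomp Require Import reals.

Set Implicit Arguments.
Unset Strict Implicit.
Unset Printing Implicit Defensive.

Import Order.TTheory GRing.Theory Num.Theory.
Local Open Scope ring_scope.

Section Distributions.
Variables (R : realType) (Omega : finType).
Implicit Types (p q : dist R Omega) (A E : {set Omega}) (f : Omega -> R).

Lemma Pr_setT p : Pr p [set: Omega] = 1.
Proof. by rewrite -(mass_sum1 p); apply: eq_bigl => w; rewrite inE. Qed.

(** The masses outside [A] are nonnegative and sum to 0, so each vanishes. *)
Lemma Pr1_mass0 q A v : Pr q A = 1 -> v \notin A -> q v = 0.
Proof.
move=> qA vA; have := mass_sum1 q.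
rewrite (bigID (mem A)) /= -/(Pr q A) qA => /eqP.
rewrite -subr_eq0 addrAC subrr add0r psumr_eq0; last by move=> w _; exact: mass_ge0.
by move=> /allP/(_ v); rewrite mem_index_enum vA => /(_ isT)/eqP.
Qed.

Lemma Pr_setI1 q A E : Pr q A = 1 -> Pr q (E :&: A) = Pr q E.
Proof.
move=> qA; rewrite /Pr [RHS](big_setID A) /= [X in _ + X]big1 ?addr0 // => w.
by rewrite inE => /andP[wA _]; apply: Pr1_mass0 qA wA.
Qed.

Lemma integral_indic q A : integral q (fun w => (w \in A)%:R) = Pr q A.
Proof.
rewrite /integral /Pr [RHS]big_mkcond; apply: eq_bigr => w _.
by case: (w \in A); rewrite (mul1r, mul0r).
Qed.

Lemma integral0 q : integral q (fun=> 0) = 0.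
Proof. by rewrite /integral big1 // => w _; rewrite mul0r. Qed.

Lemma integral_sum p n (f : 'I_n -> Omega -> R) :
  integral p (fun w => \sum_(i < n) f i w) = \sum_(i < n) integral p (f i).
Proof.
by rewrite /integral exchange_big /=; apply: eq_bigr => w _; rewrite mulr_suml.
Qed.

End Distributions.

Section InfoStructure.
Variables (R : realType) (Omega : finType) (n : nat).
Variable T : info_structure R Omega n.
Implicit Types (p : dist R Omega) (i : 'I_n) (c E : {set Omega}).
Implicit Types (f : 'I_n -> Omega -> R).

Lemma mem_cell i w : w \in pblock (part T i) w.
Proof. by rewrite mem_pblock (cover_partition (part_partition T i)) inE. Qed.

Lemma cell_part i w : pblock (part T i) w \in part T i.
Proof.
by rewrite pblock_mem // (cover_partition (part_partition T i)) inE.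
Qed.

Lemma cellP i c w : c \in part T i -> w \in c -> pblock (part T i) w = c.
Proof.
by apply: def_pblock; case/and3P: (part_partition T i).
Qed.

Lemma belief_part i c w : c \in part T i -> w \in c -> Pr (belief T i w) c = 1.
Proof. by move=> cP wc; rewrite -[in RHS](belief_cell T i w) (cellP cP wc). Qed.

Lemma belief_off_cell i c v w :
  c \in part T i -> v \in c -> w \notin c -> belief T i w v = 0.
Proof.
move=> cP vc wc; apply: Pr1_mass0 (belief_cell T i w) _.
apply: contra wc => vw.
by rewrite -(cellP cP vc) (cellP (cell_part i w) vw) mem_cell.
Qed.

(** This is stationarity of [p] under the kernel [belief T i]. Take the prior equation at the event
    [[set v]] and the cell of [v]: states outside that cell put no mass on [v], and all states
    inside it share one belief. *)
Lemma prior_mass i p v : prior T i p -> p v = \sum_w p w * belief T i w v.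
Proof.
move=> /(_ [set v] _ v (cell_part i v) (mem_cell i v)); set c := pblock _ v.
rewrite (setIidPl _) ?sub1set ?mem_cell // /Pr !big_set1 => ->.
rewrite [RHS](bigID (mem c)) /= [X in _ = _ + X]big1 ?addr0.
  rewrite mulr_sumr; apply: eq_bigr => w wc.
  by rewrite mulrC (belief_const (cell_part i v) (mem_cell i v) wc).
move=> w wc.
by rewrite (belief_off_cell (cell_part i v) (mem_cell i v) wc) mulr0.
Qed.

Lemma integral_prior i p (g : Omega -> R) : prior T i p ->
  integral p g = \sum_w p w * integral (belief T i w) g.
Proof.
move=> pr; rewrite /integral.
under eq_bigr => v _ do rewrite (prior_mass v pr) mulr_sumr.
rewrite exchange_big /=; apply: eq_bigr => w _.
by rewrite mulr_sumr; apply: eq_bigr => v _; rewrite mulrCA.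
Qed.

(** A component witnessing common certainty at [w] contains [w], which gives the inequality there.
    Conversely, if the inequalities hold everywhere, the whole space serves as the component at
    every state. *)
Lemma semi_tradeP f :
  semi_trade T f <-> forall i w, 0 <= integral (belief T i w) (f i).
Proof.
split=> [tr i w|fge0 w].
  have [S [_ wS /subsetP/(_ w wS)]] := tr w.
  by rewrite inE => /forallP.
exists [set: Omega]; split; rewrite ?inE //; last first.
  by apply/subsetP => v _; rewrite inE; apply/forallP => i.
split=> [|v i _]; first by apply/set0Pn; exists w; rewrite inE.
by exists [set: Omega]; rewrite Pr_setT.
Qed.

Lemma common_prior_no_money_pump p : common_prior T p -> ~ money_pump T p.
Proof.
move=> cp [f [/semi_tradeP fge0]]; apply/negP; rewrite -leNgt.
rewrite integral_sum; apply: sumr_ge0 => i _.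
rewrite (integral_prior (f i) (cp i)); apply: sumr_ge0 => w _.
by rewrite mulr_ge0 ?mass_ge0.
Qed.

(** A bet on [E] called off outside [c], priced at the belief of player [i] in [E]. The price is
    read at the current state; it is constant on a cell, so no representative of [c] has to be
    chosen. *)
Definition cell_bet i E c (w : Omega) : R :=
  (w \in E :&: c)%:R - (w \in c)%:R * Pr (belief T i w) E.

(** The measure [q] is arbitrary because two cases matter: [q = p] gives the defect of the prior
    equation, and [q = belief T i w] gives 0. *)
Lemma integral_cell_bet i E c w q : c \in part T i -> w \in c ->
  integral q (cell_bet i E c) =
  Pr q (E :&: c) - Pr (belief T i w) E * Pr q c.
Proof.
move=> cP wc.
rewrite -[Pr q (E :&: c)]integral_indic -[Pr q c]integral_indic.
rewrite /integral mulr_sumr -sumrB.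
apply: eq_bigr => v _; rewrite /cell_bet mulrBl; congr (_ - _).
have [vc|_] := boolP (v \in c); last by rewrite !mul0r mulr0.
by rewrite !mul1r (belief_const cP vc wc).
Qed.

Lemma integral_belief_cell_bet i E c w : c \in part T i ->
  integral (belief T i w) (cell_bet i E c) = 0.
Proof.
move=> cP; have [wc|wc] := boolP (w \in c).
  have t1 := belief_part cP wc.
  by rewrite (integral_cell_bet _ _ cP wc) Pr_setI1 // t1 mulr1 subrr.
(* Off [c] the two supports are disjoint: the bet vanishes outside [c], the belief at [w] inside
   it. *)
rewrite /integral big1 // => v _; have [vc|vc] := boolP (v \in c).
  by rewrite (belief_off_cell cP vc wc) mulr0.
by rewrite /cell_bet inE (negbTE vc) andbF mul0r subrr mul0r.
Qed.

Lemma defect_money_pump p i E c w : c \in part T i -> w \in c ->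
  Pr p (E :&: c) != Pr (belief T i w) E * Pr p c -> money_pump T p.
Proof.
move=> cP wc; rewrite -subr_eq0 -(integral_cell_bet E p cP wc).
set d := integral p _ => d0.
(* The factor [- d] turns the [p]-integral [d] of the bet into [- d ^+ 2], negative whatever the
   sign of [d]. *)
pose f j v := if j == i then - d * cell_bet i E c v else 0.
have intZ q : integral q (f i) = - d * integral q (cell_bet i E c).
  by rewrite /integral mulr_sumr; apply: eq_bigr => v _; rewrite /f eqxx mulrA.
have int0 j q : j != i -> integral q (f j) = 0.
  move=> /negbTE ji; rewrite -(integral0 q) /integral.
  by apply: eq_bigr => v _; rewrite /f ji.
exists f; split.
  apply/semi_tradeP => j v; have [->|ji] := eqVneq j i; last by rewrite int0.
  by rewrite intZ integral_belief_cell_bet // mulr0.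
rewrite integral_sum (bigD1 i) //= intZ big1 => [|j]; last exact: int0.
by rewrite addr0 mulNr oppr_lt0 -expr2 exprn_even_gt0.
Qed.

Lemma common_prior_or_money_pump p : common_prior T p \/ money_pump T p.
Proof.
(* All quantifiers range over finite types, so being a common prior is decidable, and its failure
   yields explicit [i], [E], [c] and [w]. *)
pose good := [forall i, forall E : {set Omega}, forall c : {set Omega},
  forall w, (c \in part T i) && (w \in c) ==>
    (Pr p (E :&: c) == Pr (belief T i w) E * Pr p c)].
have [gd|bad] := boolP good; [left|right].
  move=> i E c w cP wc; apply/eqP.
  move: gd => /forallP/(_ i)/forallP/(_ E)/forallP/(_ c)/forallP/(_ w).
  by rewrite cP wc.
move: bad; rewrite /good negb_forall => /existsP[i]; rewrite negb_forall => /existsP[E].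
rewrite negb_forall => /existsP[c]; rewrite negb_forall => /existsP[w].
rewrite negb_imply => /andP[/andP[cP wc]].
exact: defect_money_pump cP wc.
Qed.

End InfoStructure.

Unset Implicit Arguments.

Theorem theorem58 (R : realType) (Omega : finType) (n : nat)
  (Omega_nonempty : (0 < #|Omega|)%N) (n_gt0 : (0 < n)%N)
  (T : info_structure R Omega n) (p : dist R Omega)
  (p_strongly_maximal : strongly_maximal T p) :
  (strong_common_prior T p \/ strong_money_pump T p) /\
  ~ (strong_common_prior T p /\ strong_money_pump T p).
Proof.
split; last by case=> -[cp _] [_]; exact: common_prior_no_money_pump.
(* Strong maximality of [p] supplies the remaining conjunct in either case. *)
by have [cp|mp] := common_prior_or_money_pump T p; [left|right].
Qed.
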